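(* Let $d\in\mathbb{C}$ with $d\ne0,-1,-2,\dots$, and let $n,\nu\in\mathbb{N}_0$. Then $$\sum_{k=0}^{n}\frac{(-1)^k}{2^k}\binom nk\binom{2k}{k}\frac{\binom{k+d}{k}}{\binom{k+d-1}{k}}=\begin{cases}\dfrac{\left(\frac12\right)_\nu}{(1)_\nu}\left(1+\dfrac{2\nu}{d}\right), & n=2\nu,\\[2ex] -\dfrac1d\,\dfrac{\left(\frac32\right)_\nu}{(1)_\nu}, & n=2\nu+1.\end{cases}$$
   Context: $\mathbb{N}_0=\{0,1,2,\dots\}$. The Pochhammer symbol is $(\alpha)_0=1$, $(\alpha)_m=\alpha(\alpha+1)\cdots(\alpha+m-1)$ for $m\ge1$. Binomial coefficients with non-integer upper entry are generalized binomial coefficients; explicitly, for $k\in\mathbb{N}_0$, $\binom{k+d}{k}=\frac{(d+1)_k}{k!}$ and $\binom{k+d-1}{k}=\frac{(d)_k}{k!}$. *)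

(* Defs.v *)
From mathcomp Require Import all_boot all_order all_algebra.
From mathcomp Require Import complex.
From mathcomp Require Import reals.

Set Implicit Arguments.
Unset Strict Implicit.
Unset Printing Implicit Defensive.

Import Order.TTheory GRing.Theory Num.Theory.
Local Open Scope ring_scope.

Definition pochhammer (K : nzRingType) (a : K) (m : nat) : K :=
  \prod_(i < m) (a + i%:R).

(* Generalized binomial coefficient x (x - 1) ... (x - k + 1) / k!. *)
Definition gbinom (K : fieldType) (x : K) (k : nat) : K :=
  (\prod_(i < k) (x - i%:R)) / (k`!)%:R.

Lemma gbinom_addn (K : fieldType) (d : K) (k : nat) :
  gbinom (k%:R + d) k = pochhammer (d + 1) k / (k`!)%:R.
Proof.
congr (_ / _); rewrite /pochhammer (reindex_inj rev_ord_inj) /=.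
by apply: eq_bigr => i _; rewrite natrB // opprB addrC addrA subrK -nat1r addrC addrA.
Qed.

Lemma gbinom_addn_sub1 (K : fieldType) (d : K) (k : nat) :
  gbinom (k%:R + d - 1) k = pochhammer d k / (k`!)%:R.
Proof. by rewrite -addrA gbinom_addn subrK. Qed.

Lemma gbinom_nat (K : numFieldType) (n k : nat) :
  gbinom (n%:R : K) k = 'C(n, k)%:R.
Proof.
have fact_neq0 : (k`!)%:R != 0 :> K by rewrite pnatr_eq0 -lt0n fact_gt0.
apply: (mulIf fact_neq0); rewrite divfK // -natrM bin_ffact.
elim: k {fact_neq0} => [|k IHk]; first by rewrite big_ord0.
rewrite big_ord_recr /= IHk ffactnSr natrM.
have [le_kn | lt_nk] := leqP k n; first by rewrite natrB.
by rewrite ffact_small // !mul0r.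
Qed.

(* Main.v *)
Require Import Defs.
From mathcomp Require Import all_boot all_order all_algebra.
From mathcomp Require Import complex.
From mathcomp Require Import reals.
From mathcomp Require Import ring zify.

Set Implicit Arguments.
Unset Strict Implicit.
Unset Printing Implicit Defensive.

Import Order.TTheory GRing.Theory Num.Theory.
Local Open Scope ring_scope.

(** The ratio of the two generalized binomial coefficients is (d + k) / d, so
    the sum equals A n + B n / d, with A n the sum of
    (- 1 / 2) ^ k C(n, k) C(2 k, k), and B n the same sum weighted by k.

    Since C(2 k, k) is the coefficient of X ^ k in (1 + X) ^ (2 k), A n is the
    coefficient of X ^ n in the binomial expansion of
    (X - (1 + X) ^ 2 / 2) ^ n.  The base of this power is - (1 + X ^ 2) / 2,
    an even polynomial: A n vanishes for odd n ([central_sum_odd]) and is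
    C(2 nu, nu) / 4 ^ nu = (1 / 2)_nu / (1)_nu for n = 2 nu
    ([central_sum_even], [central_bin_pochhammer]).

    The absorption identity (n - k) C(n, k) = n C(n - 1, k) turns the weight k
    into a backward difference, B n = n (A n - A (n - 1))
    ([central_sum_weighted]).  For n > 0 one of the two terms vanishes,
    according to the parity of n, which gives the two cases. *)

Lemma pochhammerSr (K : nzRingType) (a : K) m :
  pochhammer a m.+1 = pochhammer a m * (a + m%:R).
Proof. by rewrite /pochhammer big_ord_recr. Qed.

Lemma pochhammer_shift (K : comNzRingType) (a : K) m :
  a * pochhammer (a + 1) m = pochhammer a m * (a + m%:R).
Proof.
rewrite -pochhammerSr /pochhammer big_ord_recl addr0; congr (_ * _).
by apply: eq_bigr => i _; rewrite -addrA nat1r.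
Qed.

Lemma pochhammer_neq0 (K : idomainType) (a : K) m :
  (forall i : nat, a != - i%:R) -> pochhammer a m != 0.
Proof. by move=> ha; apply/prodf_neq0 => i _; rewrite addr_eq0. Qed.

Lemma gbinom_ratio (K : numFieldType) (d : K) (k : nat) :
  (forall m : nat, d != - m%:R) ->
  gbinom (k%:R + d) k / gbinom (k%:R + d - 1) k = 1 + k%:R / d.
Proof.
move=> hd; rewrite gbinom_addn gbinom_addn_sub1.
have d_neq0 : d != 0 by rewrite -oppr0 (hd 0).
have p_neq0 := pochhammer_neq0 k hd.
have f_neq0 : (k`!)%:R != 0 :> K by rewrite pnatr_eq0 -lt0n fact_gt0.
have shift : pochhammer (d + 1) k = pochhammer d k * (d + k%:R) / d.
  by rewrite -pochhammer_shift mulrAC divff // mul1r.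
by rewrite shift; field; apply/and3P.
Qed.

(** C(2 nu + 1, nu) is the intermediate term: C(2 nu + 2, nu + 1) is its
    double, and absorption compares it with C(2 nu, nu). *)
Lemma central_binS nu :
  (nu.+1 * 'C(2 * nu.+1, nu.+1) = 2 * (2 * nu).+1 * 'C(2 * nu, nu))%N.
Proof.
have mid : ((2 * nu).+1 * 'C(2 * nu, nu) = nu.+1 * 'C((2 * nu).+1, nu))%N.
  by rewrite (mul_bin_down (2 * nu).+1 nu); congr (_ * _)%N; lia.
have -> : (2 * nu.+1 = (2 * nu).+2)%N by lia.
rewrite -(mul_bin_diag (2 * nu).+2 nu) /= -mulnA mid mulnA; congr (_ * _)%N.
by lia.
Qed.

Lemma central_bin_pochhammer (K : numFieldType) nu :
  'C(2 * nu, nu)%:R / 4 ^+ nu = pochhammer (1 / 2) nu / pochhammer 1 nu :> K.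
Proof.
elim: nu => [|nu IHnu]; first by rewrite /pochhammer !big_ord0 bin0.
have nu1_neq0 : nu%:R + 1 != 0 :> K by rewrite natr1 pnatr_eq0.
have recC : (nu%:R + 1) * 'C(2 * nu.+1, nu.+1)%:R
    = 2 * (2 * nu%:R + 1) * 'C(2 * nu, nu)%:R :> K.
  by rewrite natr1 -natrM central_binS !natrM -(natr1 (2 * nu)%N) natrM.
rewrite !pochhammerSr -mulf_div -IHnu exprS.
have -> : 'C(2 * nu.+1, nu.+1)%:R
    = 2 * (2 * nu%:R + 1) * 'C(2 * nu, nu)%:R / (nu%:R + 1) :> K.
  by rewrite -recC mulrAC divff // mul1r.
have e4 : (4 : K) ^+ nu != 0 by rewrite expf_neq0 // pnatr_eq0.
by field; rewrite addrC nu1_neq0 e4.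
Qed.

Lemma coef_exp1X (K : comNzRingType) m k :
  ((1 + 'X : {poly K}) ^+ m)`_k = 'C(m, k)%:R.
Proof.
have -> : (1 + 'X : {poly K}) ^+ m = \poly_(i < m.+1) 'C(m, i)%:R.
  rewrite exprDn poly_def; apply: eq_bigr => i _.
  by rewrite expr1n mul1r scaler_nat.
by rewrite coef_poly; case: ltnP => // lt_mk; rewrite bin_small.
Qed.

Definition central_sum (K : fieldType) (n : nat) : K :=
  \sum_(k < n.+1) (-1) ^+ k / 2 ^+ k * 'C(n, k)%:R * 'C(2 * k, k)%:R.

(** This reads off the coefficient of X ^ n on both sides of the polynomial
    identity (X - (1 + X) ^ 2 / 2) ^ n = (- 1 / 2) ^ n (1 + X ^ 2) ^ n. *)
Lemma central_sumE (K : numFieldType) n :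
  central_sum K n
    = (- 2^-1) ^+ n * (((1 + 'X : {poly K}) ^+ n) \Po 'X^2)`_n.
Proof.
have two_neq0 : 2 != 0 :> K by rewrite pnatr_eq0.
have base : 'X + (- 2^-1) *: (1 + 'X) ^+ 2
    = (- 2^-1) *: ((1 + 'X) \Po 'X^2) :> {poly K}.
  have X_scaled : 'X = (- 2^-1) *: (- ('X *+ 2)) :> {poly K}.
    by rewrite scalerN scaleNr opprK -scaler_nat scalerA mulVf // scale1r.
  rewrite [X in X + _]X_scaled -scalerDr comp_polyD comp_polyX comp_polyC; congr (_ *: _).
  by ring.
have -> : (- 2^-1) ^+ n * (((1 + 'X : {poly K}) ^+ n) \Po 'X^2)`_n
    = (('X + (- 2^-1) *: (1 + 'X) ^+ 2 : {poly K}) ^+ n)`_n.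
  by rewrite base exprZn coefZ rmorphXn.
rewrite exprDn coef_sum; apply: eq_bigr => k _.
have le_kn : (k <= n)%N by rewrite -ltnS.
rewrite exprZn -exprM coefMn -scalerAr coefZ coefXnM.
(* Only the coefficient of index n - (n - k) = k of (1 + X) ^ (2 k) matters. *)
rewrite ltnNge leq_subr /= subKn // coef_exp1X mulrAC mulr_natr.
by rewrite -exprVn -exprMn mulN1r.
Qed.

Lemma central_sum_odd (K : numFieldType) nu : central_sum K (2 * nu).+1 = 0.
Proof.
by rewrite central_sumE coef_comp_poly_Xn // dvdn2 /= mul2n odd_double mulr0.
Qed.

Lemma central_sum_even (K : numFieldType) nu :
  central_sum K (2 * nu) = pochhammer (1 / 2) nu / pochhammer 1 nu.
Proof.
rewrite central_sumE coef_comp_poly_Xn // dvdn_mulr // mulKn // coef_exp1X.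
by rewrite -central_bin_pochhammer exprM sqrrN exprVn -natrX exprVn mulrC.
Qed.

Lemma central_sum_weighted (K : numFieldType) n :
  \sum_(k < n.+1)
      (-1) ^+ k / 2 ^+ k * 'C(n, k)%:R * 'C(2 * k, k)%:R * k%:R
    = n%:R * (central_sum K n - central_sum K n.-1).
Proof.
case: n => [|n]; first by rewrite big_ord1 mulr0 mul0r.
(* The binomial coefficient C(n, n + 1) = 0 pads the shorter sum. *)
have -> : central_sum K n = \sum_(k < n.+2)
    (-1) ^+ k / 2 ^+ k * 'C(n, k)%:R * 'C(2 * k, k)%:R.
  by rewrite big_ord_recr /= bin_small // mulr0 mul0r addr0.
rewrite -sumrB mulr_sumr; apply: eq_bigr => k _.
have le_kn : (k <= n.+1)%N by rewrite -ltnS.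
have : (n.+1 * 'C(n, k))%:R = ((n.+1 - k) * 'C(n.+1, k))%:R :> K.
  by rewrite -mul_bin_down.
rewrite !natrM natrB // => absorb.
set c := (-1) ^+ k / 2 ^+ k.
transitivity (c * 'C(2 * k, k)%:R
    * (n.+1%:R * 'C(n.+1, k)%:R - n.+1%:R * 'C(n, k)%:R)); last by ring.
by rewrite absorb; ring.
Qed.

Theorem theorem4p1 (R : realType) (d : R[i])
    (hd : forall m : nat, d != - m%:R) (n nu : nat) :
  let S : R[i] :=
    \sum_(0 <= k < n.+1)
      (-1) ^+ k / 2 ^+ k * 'C(n, k)%:R * 'C(2 * k, k)%:R
        * (gbinom (k%:R + d) k / gbinom (k%:R + d - 1) k) in
  (n = (2 * nu)%N ->
     S = pochhammer (1 / 2) nu / pochhammer 1 nu * (1 + (2 * nu%:R) / d)) /\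
  (n = (2 * nu + 1)%N ->
     S = - (1 / d) * (pochhammer (3 / 2) nu / pochhammer 1 nu)).
Proof.
move=> S.
have SE : S = central_sum R[i] n
    + n%:R * (central_sum R[i] n - central_sum R[i] n.-1) / d.
  rewrite -central_sum_weighted mulr_suml -big_split /S big_mkord /=.
  apply: eq_bigr => k _.
  by rewrite gbinom_ratio // mulrDr mulr1 !mulrA.
rewrite SE; split=> ->.
- case: nu => [|nu]; first by rewrite central_sum_even !(mulr0, mul0r) !addr0 mulr1.
  have -> : (2 * nu.+1).-1 = (2 * nu).+1 by lia.
  rewrite central_sum_odd central_sum_even subr0 natrM.
  by rewrite mulrDr mulr1 mulrAC [_ * (_ / _)]mulrC.
- rewrite addn1 /= central_sum_odd central_sum_even add0r sub0r.
  have two_neq0 : 2 != 0 :> R[i] by rewrite pnatr_eq0.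
  have -> : pochhammer (3 / 2) nu
      = (2 * nu).+1%:R * pochhammer (1 / 2) nu :> R[i].
    have := pochhammer_shift (1 / 2 : R[i]) nu.
    have -> : 1 / 2 + 1 = 3 / 2 :> R[i] by field.
    move/(congr1 ( *%R 2)); rewrite mulrA mul1r divff // mul1r => ->.
    by rewrite -(natr1 (2 * nu)%N) natrM; field.
  by rewrite mul1r; ring.
Qed.
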